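(* Let $\mathcal L$ be a finite relational language, let $X$ be a Boolean sub-algebra of $\mathrm{FO}(\mathcal L)$, and let $\mathcal G$ be the class of all finite $\mathcal L$-structures. There exists an injective mapping $G\mapsto\mu_G$ from $\mathcal G$ to the space of probability measures on $\mathfrak T(X)$ such that for every $G\in\mathcal G$ and every $\phi\in X$ $$\langle\phi,G\rangle=\int_{\mathfrak T(X)}\mathbf 1_\phi(T)\,\mathrm d\mu_G(T).$$ A sequence $(G_n)_{n\in\mathbb N}$ of finite $\mathcal L$-structures is $X$-convergent if and only if the sequence $(\mu_{G_n})_{n\in\mathbb N}$ is weakly convergent. Moreover, if $\mu_{G_n}\Rightarrow\mu$ (weak convergence) then for every $\phi\in X$ $$\lim_{n\to\infty}\langle\phi,G_n\rangle=\int_{\mathfrak T(X)}\mathbf 1_\phi(T)\,\mathrm d\mu(T).$$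
   Context: $\mathrm{FO}(\mathcal L)$ is the Boolean algebra of first-order formulas over $\mathcal L$, considered up to logical equivalence. For a formula $\phi(x_1,\dots,x_p)$ with $p$ free variables and a finite $\mathcal L$-structure $G$, $$\langle\phi,G\rangle=\frac{|\{(v_1,\dots,v_p)\in G^p:\ G\models\phi(v_1,\dots,v_p)\}|}{|G|^p}$$ (adding unused free variables does not change the value; for a sentence it is $1$ if $G\models\phi$ and $0$ otherwise). A sequence $(G_n)$ of finite $\mathcal L$-structures is $X$-convergent if $(\langle\phi,G_n\rangle)_n$ converges for every $\phi\in X$. $\mathfrak T(X)$ is the Stone space of $X$: its points are the ultrafilters on $X$, and its topology is generated by the clopen sets $K(\phi)=\{T\in\mathfrak T(X):\phi\in T\}$, $\phi\in X$. $\mathbf 1_\phi$ is the indicator function of $K(\phi)$. Probability measures on $\mathfrak T(X)$ are regular, countably additive Borel probability measures. A sequence of measures $\mu_n$ is weakly convergent if $\int f\,\mathrm d\mu_n$ converges for every continuous $f:\mathfrak T(X)\to\mathbb R$; $\mu_n\Rightarrow\mu$ means $\int f\,\mathrm d\mu_n\to\int f\,\mathrm d\mu$ for every such $f$.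
   Formalization: Injectivity of G ↦ μ_G fails for general X (e.g. X={⊥,⊤}) and on isomorphic copies; instead μ_G=μ_H iff ⟨φ,G⟩=⟨φ,H⟩ for all φ∈X, and, if X contains all sentences or all quantifier-free formulas, iff G and H are isomorphic. *)

(* Defs.v *)
From HB Require Import structures.
From mathcomp Require Import all_boot all_order all_algebra.
From mathcomp Require Import generic_quotient.
From mathcomp Require Import all_classical all_reals all_analysis.
Import Order.Theory GRing.Theory Num.Theory.
Import numFieldNormedType.Exports.

Set Implicit Arguments.
Unset Strict Implicit.
Unset Printing Implicit Defensive.

Local Open Scope classical_set_scope.
Local Open Scope quotient_scope.

Record language := Language {
  relsym : finType;
  arity : relsym -> nat
}.

(* First-order formulas with equality; the variable x_(i+1) is the number i. *)
Inductive formula (L : language) : Type :=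
| FFalse
| FEq of nat & nat
| FRel (r : relsym L) of (arity r).-tuple nat
| FNot of formula L
| FAnd of formula L & formula L
| FOr of formula L & formula L
| FAll of nat & formula L
| FEx of nat & formula L.
Arguments FFalse {L}.
Arguments FEq {L}.

Fixpoint free_vars (L : language) (f : formula L) : seq nat :=
  match f with
  | FFalse => [::]
  | FEq x y => [:: x; y]
  | FRel _ xs => xs
  | FNot g => free_vars g
  | FAnd g h | FOr g h => free_vars g ++ free_vars h
  | FAll x g | FEx x g => [seq y <- free_vars g | y != x]
  end.

Fixpoint quantifier_free (L : language) (f : formula L) : bool :=
  match f with
  | FFalse | FEq _ _ | FRel _ _ => true
  | FNot g => quantifier_free g
  | FAnd g h | FOr g h => quantifier_free g && quantifier_free h
  | FAll _ _ | FEx _ _ => false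
  end.

(* The least p such that all free variables are among x_1, ..., x_p. *)
Definition nvars (L : language) (f : formula L) : nat :=
  \max_(i <- free_vars f) i.+1.

Record structure (L : language) := Structure {
  carrier :> Type;
  carrier_inhabited : inhabited carrier;
  interp : forall r : relsym L, (arity r).-tuple carrier -> Prop
}.

Record fin_structure (L : language) := FinStructure {
  fcarrier :> finType;
  fcarrier_gt0 : (0 < #|fcarrier|)%N;
  finterp : forall r : relsym L, pred ((arity r).-tuple fcarrier)
}.

Definition fs_default (L : language) (G : fin_structure L) : G :=
  enum_val (Ordinal (fcarrier_gt0 G)).

Definition structure_of_fin (L : language) (G : fin_structure L) :
    structure L :=
  {| carrier := G;
     carrier_inhabited := inhabits (fs_default G);
     interp := fun r t => finterp t |}.

Definition isomorphic (L : language) (G H : fin_structure L) : Prop :=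
  exists2 h : G -> H, bijective h &
    forall (r : relsym L) (t : (arity r).-tuple G),
      finterp t = finterp (map_tuple h t).

Definition update (T : Type) (v : nat -> T) (x : nat) (a : T) : nat -> T :=
  fun y => if y == x then a else v y.

Fixpoint sat (L : language) (M : structure L) (v : nat -> M) (f : formula L) :
    Prop :=
  match f with
  | FFalse => False
  | FEq x y => v x = v y
  | FRel r xs => interp (map_tuple v xs)
  | FNot g => ~ sat v g
  | FAnd g h => sat v g /\ sat v h
  | FOr g h => sat v g \/ sat v h
  | FAll x g => forall a : M, sat (update v x a) g
  | FEx x g => exists a : M, sat (update v x a) g
  end.

(* Equivalence in all structures, finite or infinite. *)
Definition logically_equivalent (L : language) (f g : formula L) : Prop :=
  forall (M : structure L) (v : nat -> M), sat v f <-> sat v g.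

Section FirstOrderAlgebra.
Variable L : language.

HB.instance Definition _ := gen_eqMixin (formula L).
HB.instance Definition _ := gen_choiceMixin (formula L).

Definition fequiv : rel (formula L) := fun f g => `[< logically_equivalent f g >].

Lemma fequiv_refl : reflexive fequiv.
Proof. by move=> f; apply/asboolP. Qed.

Lemma fequiv_sym : symmetric fequiv.
Proof.
by move=> f g; apply/asboolP/asboolP => fg M v; split=> /fg.
Qed.

Lemma fequiv_trans : transitive fequiv.
Proof.
move=> g f h /asboolP fg /asboolP gh; apply/asboolP => M v.
by split=> [/fg/gh|/gh/fg].
Qed.

Canonical fequiv_equiv := EquivRel fequiv fequiv_refl fequiv_sym fequiv_trans.

Definition FO : Type := {eq_quot fequiv_equiv}.

HB.instance Definition _ := Choice.on FO.
HB.instance Definition _ : EqQuotient _ fequiv_equiv FO := EqQuotient.on FO.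

Lemma FO_eqP (f g : formula L) :
  \pi_FO f = \pi_FO g <-> logically_equivalent f g.
Proof.
split=> [/eqmodP/asboolP//|fg].
by apply/eqmodP/asboolP.
Qed.

Lemma sat_repr (M : structure L) (v : nat -> M) (f : formula L) :
  sat v (repr (\pi_FO f)) <-> sat v f.
Proof. by apply: (FO_eqP _ _).1; rewrite reprK. Qed.

Definition FO_meet (p q : FO) : FO := \pi_FO (FAnd (repr p) (repr q)).
Definition FO_join (p q : FO) : FO := \pi_FO (FOr (repr p) (repr q)).
Definition FO_compl (p : FO) : FO := \pi_FO (FNot (repr p)).
Definition FO_bot : FO := \pi_FO FFalse.
Definition FO_top : FO := \pi_FO (FNot FFalse).
Definition FO_le : rel FO := fun p q => FO_meet p q == p.
Definition FO_lt : rel FO := fun p q => (q != p) && FO_le p q.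

Lemma FO_ext (p q : FO) :
  (forall (M : structure L) (v : nat -> M), sat v (repr p) <-> sat v (repr q)) ->
  p = q.
Proof. by move=> pq; rewrite -[p]reprK -[q]reprK; apply/FO_eqP. Qed.

Lemma sat_meet (M : structure L) (v : nat -> M) p q :
  sat v (repr (FO_meet p q)) <-> sat v (repr p) /\ sat v (repr q).
Proof. exact: sat_repr. Qed.

Lemma sat_join (M : structure L) (v : nat -> M) p q :
  sat v (repr (FO_join p q)) <-> sat v (repr p) \/ sat v (repr q).
Proof. exact: sat_repr. Qed.

Lemma sat_compl (M : structure L) (v : nat -> M) p :
  sat v (repr (FO_compl p)) <-> ~ sat v (repr p).
Proof. exact: sat_repr. Qed.

Lemma sat_bot (M : structure L) (v : nat -> M) : ~ sat v (repr FO_bot).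
Proof. by move/sat_repr. Qed.

Lemma sat_top (M : structure L) (v : nat -> M) : sat v (repr FO_top).
Proof. by apply/sat_repr => -[]. Qed.

Lemma FO_meetC : commutative FO_meet.
Proof. by move=> p q; apply: FO_ext => M v; rewrite !sat_meet; tauto. Qed.
Lemma FO_joinC : commutative FO_join.
Proof. by move=> p q; apply: FO_ext => M v; rewrite !sat_join; tauto. Qed.
Lemma FO_meetA : associative FO_meet.
Proof. by move=> p q r; apply: FO_ext => M v; rewrite !sat_meet; tauto. Qed.
Lemma FO_joinA : associative FO_join.
Proof. by move=> p q r; apply: FO_ext => M v; rewrite !sat_join; tauto. Qed.
Lemma FO_joinKI q p : FO_meet p (FO_join p q) = p.
Proof. by apply: FO_ext => M v; rewrite !(sat_meet, sat_join); tauto. Qed.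
Lemma FO_meetKU q p : FO_join p (FO_meet p q) = p.
Proof. by apply: FO_ext => M v; rewrite !(sat_meet, sat_join); tauto. Qed.
Lemma FO_meetUl : left_distributive FO_meet FO_join.
Proof.
by move=> p q r; apply: FO_ext => M v; rewrite !(sat_meet, sat_join); tauto.
Qed.
Lemma FO_meetxx : idempotent_op FO_meet.
Proof. by move=> p; apply: FO_ext => M v; rewrite !sat_meet; tauto. Qed.

Fact FO_display : Order.disp_t. Proof. exact: Order.Disp tt tt. Qed.

HB.instance Definition _ := @Order.isMeetJoinDistrLattice.Build FO_display FO
  FO_le FO_lt FO_meet FO_join (fun _ _ => erefl) (fun _ _ => erefl)
  FO_meetC FO_joinC FO_meetA FO_joinA FO_joinKI FO_meetKU FO_meetUl FO_meetxx.

Lemma FO_le0x (p : FO) : (FO_bot <= p)%O.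
Proof.
apply/eqP/FO_ext => M v; rewrite sat_meet.
by have := @sat_bot M v; tauto.
Qed.

Lemma FO_lex1 (p : FO) : (p <= FO_top)%O.
Proof.
apply/eqP/FO_ext => M v; rewrite sat_meet.
by have := @sat_top M v; tauto.
Qed.

HB.instance Definition _ := Order.hasBottom.Build FO_display FO FO_le0x.
HB.instance Definition _ := Order.hasTop.Build FO_display FO FO_lex1.

Lemma FO_joinxC (p : FO) : Order.join p (FO_compl p) = Order.top.
Proof.
apply: FO_ext => M v; rewrite sat_join sat_compl.
by have := @sat_top M v; have := EM (sat v (repr p)); tauto.
Qed.

Lemma FO_meetxC (p : FO) : Order.meet p (FO_compl p) = Order.bottom.
Proof.
apply: FO_ext => M v; rewrite sat_meet sat_compl.
by have := @sat_bot M v; tauto.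
Qed.

HB.instance Definition _ :=
  Order.TBDistrLattice_hasComplement.Build FO_display FO FO_joinxC FO_meetxC.

End FirstOrderAlgebra.

Definition FO_sentences (L : language) : set (FO L) :=
  [set \pi_(FO L) f | f in [set f : formula L | free_vars f = [::]]].

Definition FO_quantifier_free (L : language) : set (FO L) :=
  [set \pi_(FO L) f | f in [set f : formula L | quantifier_free f]].

Arguments FO_sentences L : clear implicits.
Arguments FO_quantifier_free L : clear implicits.

Section Density.
Variable R : realType.
Local Open Scope ring_scope.

(* The set of p-tuples satisfying f; this is meaningful when nvars f <= p, and
   the default element is then never used. *)
Definition solutions (L : language) (f : formula L) (G : fin_structure L)
    (p : nat) : {set p.-tuple G} :=
  [set v : p.-tuple G | `[< @sat L (structure_of_fin G) (nth (fs_default G) v) f >]]%SET.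

Definition formula_density (L : language) (f : formula L)
    (G : fin_structure L) : R :=
  #|solutions f G (nvars f)|%:R / (#|G| ^ nvars f)%:R.

Definition density (L : language) (phi : FO L) (G : fin_structure L) : R :=
  formula_density (repr phi) G.

Lemma sat_agree (L : language) (M : structure L) (f : formula L)
    (v w : nat -> M) :
  {in free_vars f, v =1 w} -> sat v f <-> sat w f.
Proof.
elim: f v w => [|x y|r xs|g IH|g IHg h IHh|g IHg h IHh|x g IH|x g IH] v w vw //=.
- by rewrite !vw ?inE ?eqxx ?orbT.
- suff -> : map_tuple v xs = map_tuple w xs by [].
  by apply: val_inj; apply/eq_in_map => y /vw.
- by rewrite (IH v w).
- by rewrite (IHg v w) ?(IHh v w)// => y yf; apply: vw; rewrite mem_cat yf ?orbT.
- by rewrite (IHg v w) ?(IHh v w)// => y yf; apply: vw; rewrite mem_cat yf ?orbT.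
- have E a : sat (update v x a) g <-> sat (update w x a) g.
    apply: IH => y yg; rewrite /update; case: (eqVneq y x) => // yx.
    by apply: vw; rewrite mem_filter yx.
  by split=> H a; apply/E.
- have E a : sat (update v x a) g <-> sat (update w x a) g.
    apply: IH => y yg; rewrite /update; case: (eqVneq y x) => // yx.
    by apply: vw; rewrite mem_filter yx.
  by split=> -[a /E Ha]; exists a.
Qed.

Lemma card_solutionsS (L : language) (f : formula L) (G : fin_structure L)
    (p : nat) : (nvars f <= p)%N ->
  #|solutions f G p.+1| = (#|solutions f G p| * #|G|)%N.
Proof.
move=> fp; rewrite -[#|G|]cardsT -cardsX.
pose h (u : p.-tuple G * G) := [tuple of rcons u.1 u.2].
have h_inj : injective h.
  by move=> [s x] [t y] /(congr1 val)/= /rcons_inj[/val_inj-> ->].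
rewrite -(card_imset _ h_inj); apply: eq_card => t.
have satE (s : p.-tuple G) x :
    (h (s, x) \in solutions f G p.+1) = (s \in solutions f G p).
  rewrite !inE; apply: asbool_equiv_eq; apply: sat_agree => i fi /=.
  rewrite nth_rcons size_tuple (leq_trans _ fp)//.
  by rewrite /nvars (big_rem i fi)/= leq_max leqnn.
apply/idP/imsetP => [|[[s x]]]; last by rewrite inE => /andP[sf _] ->; rewrite satE.
case/tupleP: t => x s.
have -> : [tuple of x :: s] = h ([tuple of belast x s], last x s).
  by apply: val_inj; rewrite /= -lastI.
by rewrite satE => tf; eexists; last by []; rewrite inE tf inE.
Qed.

(* Adding unused free variables does not change the value. *)
Lemma formula_densityE (L : language) (f : formula L) (G : fin_structure L)
    (p : nat) : (nvars f <= p)%N ->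
  formula_density f G = #|solutions f G p|%:R / (#|G| ^ p)%:R.
Proof.
elim: p => [|p IH]; first by rewrite leqn0 /formula_density => /eqP ->.
rewrite leq_eqVlt => /orP[/eqP<-//|fp].
rewrite IH// card_solutionsS// expnSr !natrM -mulf_div divff ?mulr1//.
by rewrite pnatr_eq0 -lt0n fcarrier_gt0.
Qed.

Lemma densityE (L : language) (f : formula L) (G : fin_structure L) :
  density (\pi_(FO L) f) G = formula_density f G.
Proof.
rewrite /density; set g := repr _.
rewrite !(@formula_densityE _ _ _ (maxn (nvars f) (nvars g))) ?leq_max ?leqnn ?orbT//.
congr (_%:R / _); apply: eq_card => t; rewrite !inE.
exact/asbool_equiv_eq/sat_repr.
Qed.

Definition X_convergent (L : language) (X : set (FO L))
    (G : nat -> fin_structure L) : Prop :=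
  forall phi, X phi -> cvgn (fun n => density phi (G n)).

End Density.

Record bool_subalgebra d (B : ctbDistrLatticeType d) := BoolSubalgebra {
  subalgebra_set :> set B;
  subalgebra_bot : subalgebra_set Order.bottom;
  subalgebra_top : subalgebra_set Order.top;
  subalgebra_meet : forall a b, subalgebra_set a -> subalgebra_set b ->
    subalgebra_set (Order.meet a b);
  subalgebra_join : forall a b, subalgebra_set a -> subalgebra_set b ->
    subalgebra_set (Order.join a b);
  subalgebra_compl : forall a, subalgebra_set a ->
    subalgebra_set (Order.compl a)
}.

Section Stone.
Context d (B : ctbDistrLatticeType d).

Definition proper_filter_on (X U : set B) : Prop :=
  [/\ U `<=` X, U Order.top, ~ U Order.bottom,
      forall a b, U a -> U b -> U (Order.meet a b) &
      forall a b, U a -> X b -> (a <= b)%O -> U b].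

Definition ultrafilter_on (X U : set B) : Prop :=
  proper_filter_on X U /\
  forall V, proper_filter_on X V -> U `<=` V -> U = V.

Lemma ultrafilter_onP (X : bool_subalgebra B) (U : set B) :
  proper_filter_on X U -> (forall a, subalgebra_set X a -> U a \/ U (Order.compl a)) ->
  ultrafilter_on X U.
Proof.
move=> FU dec; split=> // V [VX _ V0 VI VU] UV; apply/seteqP; split=> // a Va.
have [//|/UV Va'] := dec _ (VX _ Va).
by case: V0; rewrite -(meetxC a); exact: VI.
Qed.

End Stone.

Section StoneSpace.
Variables (L : language) (X : bool_subalgebra (FO L)).

Record stone := Ultrafilter {
  ultrafilter_set :> set (FO L);
  ultrafilter_setP : ultrafilter_on X ultrafilter_set
}.

Definition stone_K (phi : FO L) : set stone := [set T : stone | ultrafilter_set T phi].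

(* A point of the Stone space, as required by measurableType: the type of an
   assignment in a one-element structure. *)
Let M1 : structure L := @Structure L unit (inhabits tt) (fun _ _ => True).
Let v1 : nat -> M1 := fun _ => tt.
Let U1 : set (FO L) := [set phi | (X : set (FO L)) phi /\ sat v1 (repr phi)].

Lemma stone_point_subproof : ultrafilter_on X U1.
Proof.
apply: ultrafilter_onP; first split.
- by move=> a [].
- by split; [exact: subalgebra_top|exact: sat_top].
- by case=> _ /sat_bot.
- by move=> a b [Xa sa] [Xb sb]; split; [exact: subalgebra_meet|exact/sat_meet].
- move=> a b [Xa sa] Xb /meet_idPl ab; split=> //.
  by move: sa; rewrite -ab => /sat_meet[].
- move=> a Xa; have [sa|sa] := EM (sat v1 (repr a)); [left|right]; split=> //.
    exact: subalgebra_compl.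
  suff : sat v1 (repr (Order.join a (Order.compl a))) by move/sat_join => [].
  by rewrite joinxC; exact: sat_top.
Qed.

HB.instance Definition _ := gen_eqMixin stone.
HB.instance Definition _ := gen_choiceMixin stone.
HB.instance Definition _ := isPointed.Build stone (Ultrafilter stone_point_subproof).
HB.instance Definition _ :=
  isSubBaseTopological.Build stone [set stone_K phi | phi in (X : set (FO L))] id.

End StoneSpace.

Arguments stone_K {L} X phi.

Section Measures.
Variable R : realType.

Definition borel (T : ptopologicalType) := g_sigma_algebraType (@open T).

Definition regular_measure (T : ptopologicalType)
    (mu : probability (borel T) R) : Prop :=
  forall A : set (borel T), measurable A ->
    mu A = ereal_sup [set mu K | K in [set K : set T | compact K /\ K `<=` A]] /\
    mu A = ereal_inf [set mu V | V in [set V : set T | open V /\ A `<=` V]].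

Local Open Scope ring_scope.

Definition weakly_convergent (T : ptopologicalType)
    (mu : nat -> probability (borel T) R) : Prop :=
  forall f : T -> R, continuous f -> cvgn (fun n => \int[mu n]_x f x).

Definition weakly_converges_to (T : ptopologicalType)
    (mu : nat -> probability (borel T) R) (nu : probability (borel T) R) : Prop :=
  forall f : T -> R, continuous f ->
    (fun n => \int[mu n]_x f x) @ \oo --> \int[nu]_x f x.

(* Equality as Borel measures; the library's measures also take (junk) values
   on non-measurable sets. *)
Definition same_measure (T : ptopologicalType)
    (mu nu : probability (borel T) R) : Prop :=
  forall A : set (borel T), measurable A -> mu A = nu A.

End Measures.

(* Main.v *)
(* A uniform point x of [0, 1[ yields a random assignment of the variables in
   G, whose values are the elements of G numbered by the base-#|G| digits of x;
   these values are independent and uniform on G. The measure mu_G is the law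
   of the set of those formulas of X that this assignment satisfies, so K(phi)
   has mass <phi, G>. As the language is finite, X is countable: the clopen sets
   K(phi) form a pi-system generating the Borel sets, so they determine mu_G,
   and open sets are F_sigma, which gives regularity on the compact Stone space.
   By compactness a continuous function is a uniform limit of step functions
   over clopen sets, so weak convergence reduces to convergence on each K(phi).
   Finally the quantifier-free diagram of G (or its existential closure) has
   positive density in H iff G embeds in H, and finite structures that embed in
   each other are isomorphic. *)
Require Import Defs.
From HB Require Import structures.
From mathcomp Require Import all_boot all_order all_algebra.
From mathcomp Require Import all_classical all_reals all_analysis.
From mathcomp Require Import ring.
Import Order.TTheory Order.Theory GRing.Theory Num.Theory.
Import numFieldNormedType.Exports.
Local Open Scope classical_set_scope.
Local Open Scope ring_scope.

Set Implicit Arguments.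
Unset Strict Implicit.
Unset Printing Implicit Defensive.

(** * Countability of the algebra of formulas *)

Fixpoint formula_code (L : language) (f : formula L) : nat :=
  match f with
  | FFalse => pickle (0, 0, 0)%N
  | FEq x y => pickle (1, x, y)%N
  | FRel r xs => pickle (2, pickle r, pickle (tval xs))%N
  | FNot g => pickle (3, formula_code g, 0)%N
  | FAnd g h => pickle (4, formula_code g, formula_code h)%N
  | FOr g h => pickle (5, formula_code g, formula_code h)%N
  | FAll x g => pickle (6, x, formula_code g)%N
  | FEx x g => pickle (7, x, formula_code g)%N
  end.

Lemma formula_code_inj (L : language) : injective (@formula_code L).
Proof.
elim=> [|x y|r xs|g IH|g IHg h IHh|g IHg h IHh|x g IH|x g IH]
  [|x' y'|r' xs'|g'|g' h'|g' h'|x' g'|x' g'] //= /(pcan_inj pickleK)[] //.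
- by move=> -> ->.
- move=> /(pcan_inj pickleK) rr'; rewrite -{}rr' in xs' *.
  by move=> /(pcan_inj pickleK)/val_inj ->.
- by move=> /IH ->.
- by move=> /IHg -> /IHh ->.
- by move=> /IHg -> /IHh ->.
- by move=> -> /IH ->.
- by move=> -> /IH ->.
Qed.

(** A class is coded by its chosen representative. Countability later turns every open set of the
    Stone space into a countable union of clopen sets. *)
Lemma countable_FO (L : language) : countable [set: FO L].
Proof.
apply/countable_injP; exists (fun phi => formula_code (repr phi)) => p q _ _.
by move=> /formula_code_inj/(can_inj reprK).
Qed.

Lemma free_vars_lt_nvars (L : language) (f : formula L) (i : nat) :
  i \in free_vars f -> (i < nvars f)%N.
Proof. by move=> fi; rewrite /nvars (big_rem i fi)/= leq_max leqnn. Qed.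

(** * Embeddings, isomorphisms and diagrams of finite structures *)

Section Embeddings.
Local Open Scope quotient_scope.
Variable L : language.
Implicit Types (G H : fin_structure L) (f : formula L).

Definition embeds G H : Prop :=
  exists2 h : G -> H, injective h &
    forall (r : relsym L) (t : (arity r).-tuple G),
      finterp t = finterp (map_tuple h t).

(** The injection back bounds the cardinality of [H] by that of [G], so [h] is a bijection, and it
    respects the relations in both directions. *)
Lemma embeds_antisym G H : embeds G H -> embeds H G -> isomorphic G H.
Proof.
move=> [h h_inj hP] [k k_inj _]; exists h => //.
by apply: inj_card_bij => //; exact: leq_card k_inj.
Qed.

Lemma sat_iso G H (h : G -> H) (v : nat -> G) f : bijective h ->
  (forall (r : relsym L) (t : (arity r).-tuple G),
    finterp t = finterp (map_tuple h t)) ->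
  @sat L (structure_of_fin G) v f <-> @sat L (structure_of_fin H) (h \o v) f.
Proof.
move=> hbij hP; have [k hk kh] := hbij.
have updE w x a g :
    @sat L (structure_of_fin H) (h \o update w x a) g <->
    @sat L (structure_of_fin H) (update (h \o w) x (h a)) g.
  by apply: sat_agree => y _; rewrite /update /=; case: ifP.
elim: f v => [|x y|r xs|g IH|g IHg g' IHg'|g IHg g' IHg'|x g IH|x g IH] v //=.
- by split=> [->//|/(can_inj hk)].
- suff E : map_tuple h (map_tuple v xs) = map_tuple (h \o v) xs by rewrite hP E.
  by apply: val_inj; rewrite /= -map_comp.
- by rewrite IH.
- by rewrite IHg IHg'.
- by rewrite IHg IHg'.
(* In the quantifier cases, surjectivity is what matters: an element [a] of [H] is tested at its
   preimage [k a] in [G]. *)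
- split=> gP a; last by apply/IH/updE/gP.
  by have /IH/updE := gP (k a); rewrite kh.
- split=> -[a ga]; first by exists (h a); apply/updE/IH.
  by exists (k a); apply/IH/updE; rewrite kh.
Qed.

Lemma solutions_neq0 G f : solutions f G (nvars f) != finset.set0 <->
  exists v, @sat L (structure_of_fin G) v f.
Proof.
split=> [/set0Pn[t]|[v vf]].
  by rewrite inE => /asboolP; exists (nth (fs_default G) t).
apply/set0Pn; exists [tuple v i | i < nvars f]; rewrite inE; apply/asboolP.
move: vf; apply: (sat_agree _).1 => i fi.
have ip := free_vars_lt_nvars fi.
by rewrite -(tnth_nth _ _ (Ordinal ip)) tnth_mktuple.
Qed.

(** Applying [h] coordinatewise is a bijection on tuples that carries solutions onto solutions. *)
Lemma isomorphic_density (R : realType) G H f : isomorphic G H ->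
  formula_density R f G = formula_density R f H.
Proof.
move=> [h hbij hP]; have h_inj := bij_inj hbij.
have [k hk kh] := hbij.
rewrite /formula_density (bij_eq_card hbij); congr (_%:R / _).
have map_inj : injective (map_tuple h : (nvars f).-tuple G -> _).
  by move=> s t /(congr1 val)/= /(inj_map h_inj)/val_inj.
rewrite -(card_imset _ map_inj); apply: eq_card => t; rewrite inE.
have solE (s : (nvars f).-tuple G) :
    @sat L (structure_of_fin G) (nth (fs_default G) s) f <->
    @sat L (structure_of_fin H) (nth (fs_default H) (map_tuple h s)) f.
  rewrite (sat_iso _ _ hbij hP); apply: sat_agree => i fi /=.
  by rewrite (nth_map (fs_default G))// size_tuple free_vars_lt_nvars.
apply/imsetP/asboolP => [[s + ->]|tf]; first by rewrite inE => /asboolP/solE.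
have tE : t = map_tuple h (map_tuple k t).
  by apply: val_inj; rewrite /= -map_comp map_id_in// => x _ /=; rewrite kh.
by exists (map_tuple k t) => //; rewrite inE; apply/asboolP/solE; rewrite -tE.
Qed.

Definition conj_seq (I : Type) (s : seq I) (F : I -> formula L) : formula L :=
  foldr (fun i => FAnd (F i)) (FNot FFalse) s.

Lemma sat_conj_seq (I : eqType) (s : seq I) (F : I -> formula L)
    (M : structure L) (v : nat -> M) :
  sat v (conj_seq s F) <-> forall i, i \in s -> sat v (F i).
Proof.
elim: s => [|i s IH] /=; first by split=> // _ [].
rewrite IH; split=> [[Fi Fs] j|Fs].
  by rewrite inE => /predU1P[->//|/Fs].
by split=> [|j js]; apply: Fs; rewrite inE ?eqxx ?js ?orbT.
Qed.

Lemma quantifier_free_conj_seq (I : Type) (s : seq I) (F : I -> formula L) :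
  (forall i, quantifier_free (F i)) -> quantifier_free (conj_seq s F).
Proof. by move=> qF; elim: s => //= i s ->; rewrite qF. Qed.

(** The variable numbered [rk g] names [g]. The first conjunction forces distinct names to have
    distinct values; the second fixes the truth value of every atom on tuples of [G]. *)
Definition diagram G : formula L :=
  let rk (g : G) : nat := enum_rank g in
  FAnd
    (conj_seq (enum {: G * G}) (fun p =>
      if p.1 == p.2 then FNot FFalse else FNot (FEq (rk p.1) (rk p.2))))
    (conj_seq (enum {: {r : relsym L & (arity r).-tuple G}}) (fun p =>
      let atom := FRel (map_tuple rk (tagged p)) in
      if finterp (tagged p) then atom else FNot atom)).

Lemma diagram_quantifier_free G : quantifier_free (diagram G).
Proof.
rewrite /= !quantifier_free_conj_seq// => p; first by case: ifP.
by case: ifP.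
Qed.

(** An assignment satisfying the diagram, read through [enum_rank], is an embedding, and
    conversely. *)
Lemma sat_diagramP G H :
  (exists v, @sat L (structure_of_fin H) v (diagram G)) <-> embeds G H.
Proof.
split=> [[v [/sat_conj_seq vne /sat_conj_seq vrel]]|[h h_inj hP]].
  exists (fun g => v (enum_rank g)) => [x y vxy|r t].
    have /= := vne (x, y) (mem_enum _ _).
    by case: eqVneq => //= _ [].
  have E : map_tuple v (map_tuple (fun g : G => enum_rank g : nat) t) =
           map_tuple (fun g => v (enum_rank g)) t.
    by apply: val_inj; rewrite /= -map_comp.
  have /= := vrel (Tagged _ t) (mem_enum _ _).
  by case: ifP => /= _; rewrite E; [move->|move/negP/negbTE->].
(* Indices from [#|G|] on receive the image of the default element; the diagram mentions none of
   them. *)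
pose v (i : nat) : H := h (nth (fs_default G) (enum G) i).
have vE (g : G) : v (enum_rank g) = h g by rewrite /v nth_enum_rank.
exists v; split; apply/sat_conj_seq => p _ /=.
  case: ifPn => /= [_ []|pne]; rewrite !vE => /h_inj/eqP.
  by rewrite (negbTE pne).
have E : map_tuple v (map_tuple (fun g : G => enum_rank g : nat) (tagged p)) =
         map_tuple h (tagged p).
  by apply: val_inj; rewrite /= -map_comp; apply: eq_map => g /=; rewrite vE.
by case: ifPn; rewrite hP /= E// => /negP.
Qed.

(** This makes the diagram available when [X] is only known to contain the sentences. *)
Definition ex_closure f : formula L := foldr (@FEx L) f (free_vars f).

Lemma free_vars_ex_closure f : free_vars (ex_closure f) = [::].
Proof.
have E s : free_vars (foldr (@FEx L) f s) = [seq y <- free_vars f | y \notin s].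
  elim: s => [|x s IH] /=; first by rewrite filter_predT.
  by rewrite IH -filter_predI; apply: eq_filter => y /=; rewrite inE negb_or.
rewrite /ex_closure E (eq_in_filter (a2 := pred0)) ?filter_pred0// => y.
by move=> ->.
Qed.

Lemma sat_ex_closure (M : structure L) f :
  (exists v : nat -> M, sat v (ex_closure f)) <-> exists v : nat -> M, sat v f.
Proof.
rewrite /ex_closure; elim: (free_vars f) => //= x s IH; rewrite -IH.
split=> [[v [a va]]|[v vf]]; first by exists (update v x a).
exists v, (v x); move: vf; apply: (sat_agree _).1 => y _.
by rewrite /update; case: eqP => // ->.
Qed.

(** A density is positive exactly when the formula is satisfiable. Equal densities therefore make
    the diagram of each structure satisfiable in the other, which gives embeddings both ways. *)
Lemma density_isomorphic (R : realType) (X : set (FO L)) G H :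
  FO_sentences L `<=` X \/ FO_quantifier_free L `<=` X ->
  (forall phi, X phi -> density R phi G = density R phi H) -> isomorphic G H.
Proof.
move=> XP GH.
have transfer f G' H' :
    density R (\pi_(FO L) f) G' = density R (\pi_(FO L) f) H' ->
    (exists v, @sat L (structure_of_fin G') v f) ->
    exists v, @sat L (structure_of_fin H') v f.
  rewrite !densityE => E /solutions_neq0; rewrite -card_gt0 => G0.
  apply/solutions_neq0; rewrite -card_gt0 lt0n; apply/eqP => H0.
  suff : 0 < formula_density R f G' by rewrite E /formula_density H0 mul0r ltxx.
  by rewrite divr_gt0// ltr0n// expn_gt0 fcarrier_gt0.
have embed G' H' :
    (forall phi, X phi -> density R phi G' = density R phi H') -> embeds G' H'.
  move=> E; apply/sat_diagramP.
  have : exists v, @sat L (structure_of_fin G') v (diagram G').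
    apply/sat_diagramP; exists id => // r t; congr finterp.
    by apply: val_inj; rewrite /= map_id.
  case: XP => XP; last first.
    have Xd : X (\pi_(FO L) (diagram G')).
      by apply: XP; exists (diagram G') => //; exact: diagram_quantifier_free.
    exact: transfer (E _ Xd).
  have Xd : X (\pi_(FO L) (ex_closure (diagram G'))).
    apply: XP; exists (ex_closure (diagram G')) => //.
    exact: free_vars_ex_closure.
  by move/sat_ex_closure/(transfer _ _ _ (E _ Xd))/sat_ex_closure.
by apply: embeds_antisym; apply: embed => // phi /GH.
Qed.

End Embeddings.

(** * The uniform measure on the unit interval *)

Section UniformMeasure.
Variable R : realType.

Definition unif01 : set _ -> \bar R :=
  mrestr (@lebesgue_measure R) (measurable_itv `[0%R, 1%R[).

HB.instance Definition _ := Measure.copy unif01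
  (mrestr (@lebesgue_measure R) (measurable_itv `[0%R, 1%R[)).

Lemma unif01_setT : unif01 setT = 1%E.
Proof.
rewrite /unif01/mrestr setTI lebesgue_measure_itv/= lte_fin ltr01.
by rewrite -EFinB subr0.
Qed.

HB.instance Definition _ :=
  Measure_isProbability.Build _ _ _ unif01 unif01_setT.

Variable N : nat.
Hypothesis N0 : (0 < N)%N.

Let NR0 : 0 < N%:R :> R. Proof. by rewrite ltr0n. Qed.

Lemma measurable_truncn (P : pred nat) :
  measurable [set x : R | P (Num.truncn (x * N%:R))].
Proof.
(* Truncation sends negative reals to 0, so these sets are whole left half-lines; differences of
   consecutive ones are the level sets. *)
pose le (k : nat) := [set x : R | (Num.truncn (x * N%:R) <= k)%N].
have mle k : measurable (le k).
  rewrite (_ : le k = `]-oo, (k.+1%:R / N%:R)[%classic).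
    exact: measurable_itv.
  by apply/seteqP; split=> x; rewrite /le /= in_itv/= truncn_le_nat ltr_pdivlMr.
rewrite (_ : mkset _ = \bigcup_(k in [set k | P k])
    (le k `\` if k is j.+1 then le j else set0)).
  apply: bigcup_measurable => k _; apply: measurableD => //.
  by case: k => [|k]; [exact: measurable0|exact: mle].
apply/seteqP; split=> [x Px|x [k Pk [xk nxk]]].
  exists (Num.truncn (x * N%:R)) => //; split; first exact: leqnn.
  case E: (Num.truncn _) => [|k]; first by case.
  by rewrite /le /= E ltnn.
rewrite /= (_ : Num.truncn _ = k)//; apply/eqP.
rewrite eqn_leq [(_ <= k)%N]xk/=.
by case: k nxk {Pk xk} => // k /negP; rewrite -ltnNge.
Qed.

(** The unit interval splits into [N] intervals [I k] of length 1/N, on each of which the truncation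
    is constantly [k]. *)
Lemma unif01_truncn (P : pred nat) :
  unif01 [set x : R | P (Num.truncn (x * N%:R))] =
  (#|[set k : 'I_N | P k]%SET|%:R / N%:R)%:E.
Proof.
pose I (k : 'I_N) : set R := `[(k%:R / N%:R), (k.+1%:R / N%:R)[%classic.
have IP (k : 'I_N) x : I k x -> 0 <= x /\ Num.truncn (x * N%:R) = k.
  rewrite /I /= in_itv/= ler_pdivrMr// ltr_pdivlMr// => kx.
  split; last exact: truncn_def.
  by rewrite -(pmulr_lge0 _ NR0); case/andP: kx => + _; apply: le_trans.
have muI (k : 'I_N) : lebesgue_measure (I k) = (N%:R^-1)%:E.
  rewrite lebesgue_measure_itv/= lte_fin ltr_pM2r ?invr_gt0// ltr_nat ltnSn.
  by rewrite -EFinB -mulrBl -natrB// subSnn mul1r.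
rewrite /unif01 /mrestr (_ : _ `&` _ = \big[setU/set0]_(k < N | P k) I k).
  rewrite measure_bigsetU_ord_cond.
  - rewrite (eq_bigr (fun=> (N%:R^-1)%:E)); last by move=> k _; exact: muI.
    by rewrite sumEFin sumr_const -[_^-1 *+ _]mulr_natl cardsE.
  - by move=> k _; exact: measurable_itv.
  - by move=> i j _ _ [x [/IP[_ xi] /IP[_ xj]]]; apply: val_inj; rewrite /= -xi.
apply/seteqP; split=> [x [/= Px]|x]; rewrite -bigcup_seq_cond.
  rewrite in_itv/= => /andP[x0 x1].
  have kN : (Num.truncn (x * N%:R) < N)%N.
    by rewrite truncn_lt_nat ?mulr_ge0// gtr_pMl.
  exists (Ordinal kN); first by rewrite /= mem_index_enum.
  by rewrite /I /= in_itv/= ler_pdivrMr// ltr_pdivlMr// truncn_itv// mulr_ge0.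
move=> [k /= /andP[_ Pk] /[dup] /IP[x0 xk]].
rewrite /I /= !in_itv/= xk x0 => /andP[_ xk1]; split=> //=.
by rewrite (lt_le_trans xk1)// ler_pdivrMr// mul1r ler_nat.
Qed.

End UniformMeasure.

(** * Digits in base [g] *)

Section Digits.
Variable g : nat.
Hypothesis g0 : (0 < g)%N.

(** Digits of a [p]-digit number are counted from the most significant one, so that longer
    expansions of one real prolong shorter ones. *)
Definition digit (p k i : nat) : nat := ((k %/ g ^ (p - i.+1)) %% g)%N.

Lemma digit_inj (p k l : nat) : (k < g ^ p)%N -> (l < g ^ p)%N ->
  (forall i, (i < p)%N -> digit p k i = digit p l i) -> k = l.
Proof.
elim: p k l => [|p IH] k l.
  by rewrite expn0 !ltnS !leqn0 => /eqP-> /eqP->.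
move=> kp lp kl; rewrite (divn_eq k g) (divn_eq l g); congr (_ * _ + _)%N.
  apply: IH => [||i ip]; rewrite ?ltn_divLR -?expnSr//.
  have := kl i (ltnW ip); rewrite /digit -!divnMA -!expnS -subSn//.
by have := kl p (ltnSn p); rewrite /digit subnn expn0 !divn1.
Qed.

Lemma truncn_div (R : realType) (y : R) (m : nat) : (0 < m)%N ->
  Num.truncn (y / m%:R) = (Num.truncn y %/ m)%N.
Proof.
move=> m0; have mR : 0 < m%:R :> R by rewrite ltr0n.
have [y0|y0] := leP 0 y; last first.
  have ny (z : R) : z < 0 -> Num.truncn z = 0%N.
    by move=> z0; apply/truncn0Pn; rewrite -ltNge (lt_trans z0).
  by rewrite !ny ?div0n// pmulr_llt0// invr_gt0.
apply: truncn_def; rewrite ler_pdivlMr// ltr_pdivrMr// -!natrM.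
by rewrite -truncn_ge_nat// -truncn_lt_nat// leq_divM ltn_ceil.
Qed.

(** The right-hand side does not depend on [p]: a single real thus fixes the values of all variables
    at once, whatever the number of variables of a formula. *)
Lemma digit_truncn (R : realType) (x : R) (p i : nat) : (i < p)%N ->
  digit p (Num.truncn (x * (g ^ p)%:R)) i =
  (Num.truncn (x * (g ^ i.+1)%:R) %% g)%N.
Proof.
move=> ip; rewrite /digit -truncn_div ?expn_gt0 ?g0//.
congr (Num.truncn _ %% _)%N.
rewrite -{1}(subnKC ip) expnD natrM mulrA mulfK//.
by rewrite pnatr_eq0 -lt0n expn_gt0 g0.
Qed.

End Digits.

(** * Regularity of Borel probability measures *)

Section Regularity.
Local Open Scope ereal_scope.
Variables (R : realType) (T : ptopologicalType) (mu : probability (borel T) R).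

Definition approximable (A : set (borel T)) : Prop :=
  forall e : R, (0 < e)%R -> exists K V : set T,
    [/\ closed K, open V, K `<=` A, A `<=` V &
        mu ((V : set (borel T)) `\` K) <= e%:E].

Lemma borel_open (V : set T) : open V -> measurable (V : set (borel T)).
Proof. exact: sub_sigma_algebra. Qed.

Lemma borel_closed (K : set T) : closed K -> measurable (K : set (borel T)).
Proof.
move=> cK; rewrite -[K]setCK; apply: measurableC; apply: borel_open.
exact: closed_openC.
Qed.

(** The sets left after removing the first [n] pieces decrease to the empty set, so continuity from
    above applies to the finite measure. *)
Lemma fsigma_residual (F : nat -> set T) (e : R) : (0 < e)%R ->
  (forall n, measurable (F n : set (borel T))) ->
  exists n, mu ((\bigcup_k F k) `\` \big[setU/set0]_(i < n) F i) <= e%:E.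
Proof.
move=> e0 mF.
pose B n : set (borel T) := (\bigcup_k F k) `\` \big[setU/set0]_(i < n) F i.
have mB n : measurable (B n).
  by apply: measurableD; [exact: bigcup_measurable|exact: bigsetU_measurable].
have B0 : \bigcap_n B n = set0.
  apply/seteqP; split=> // x Bx; have [[k _ Fkx] _] := Bx 0%N I.
  by have [_] := Bx k.+1 I; apply; rewrite -bigcup_mkord; exists k => /=.
have : mu \o B @ \oo --> mu set0.
  rewrite -B0; apply: nonincreasing_cvg_mu => //.
  - by rewrite -ge0_fin_numE// fin_num_measure.
  - by rewrite B0; exact: measurable0.
  - move=> m n mn; apply/subsetPset => x [Fx nx]; split=> // nx'; apply: nx.
    move: nx'; rewrite -!bigcup_mkord => -[i /= im Fi].
    by exists i => //=; exact: leq_trans mn.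
rewrite measure0 => /fine_cvgP[_].
move=> /cvgrPdist_le/(_ e e0)[n _ /(_ n (leqnn n))/=].
rewrite sub0r normrN => ne; exists n.
rewrite -[leLHS](@fineK _ (mu (B n))) ?fin_num_measure// lee_fin.
exact: le_trans (ler_norm _) ne.
Qed.

(** Complementation exchanges the closed inner set and the open outer set; countable unions are
    handled by splitting the error [e] into two halves. *)
Lemma approx_sigma_algebra : sigma_algebra setT approximable.
Proof.
split.
- move=> e e0; exists set0, set0.
  split; [exact: closed0|exact: open0|by []|by []|].
  by rewrite setD0 measure0 lee_fin ltW.
- move=> A tA e /tA[K [V [cK oV KA AV KV]]]; exists (~` V), (~` K); split.
  + exact: open_closedC.
  + exact: closed_openC.
  + by rewrite setTD; exact: subsetC.
  + by rewrite setTD; exact: subsetC.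
  + by rewrite setDE setCK setIC -setDE.
- move=> A tA e e0; have e2 : (0 < e / 2)%R by rewrite divr_gt0.
  have {tA}/choice[KV KVP] : forall n, exists KV : set T * set T,
      [/\ closed KV.1, open KV.2, KV.1 `<=` A n, A n `<=` KV.2 &
          mu ((KV.2 : set (borel T)) `\` KV.1) <= (e / 2 / (2 ^ n.+1)%:R)%:E].
    move=> n; have [|K [V KV]] := tA n (e / 2 / (2 ^ n.+1)%:R)%R.
      by rewrite divr_gt0// ltr0n expn_gt0.
    by exists (K, V).
  pose K n : set (borel T) := (KV n).1; pose V n : set (borel T) := (KV n).2.
  have mK n : measurable (K n).
    by have [cK _ _ _ _] := KVP n; exact: borel_closed.
  have mV n : measurable (V n) by have [_ oV _ _ _] := KVP n; exact: borel_open.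
  (* An infinite union of closed sets need not be closed, so it is cut at [N], at a cost of at most
     e/2; the gaps between the [V n] and [K n] sum to at most the other half. *)
  have [N KN] := fsigma_residual e2 mK.
  exists (\big[setU/set0]_(i < N) K i), (\bigcup_n V n); split.
  + by apply: closed_bigsetU => i _; have [] := KVP i.
  + by apply: bigcup_open => i _; have [] := KVP i.
  + rewrite -bigcup_mkord => x [i _ Kx]; exists i => //.
    by have [_ _ + _ _] := KVP i; apply.
  + move=> x [i _ Ax]; exists i => //; have [_ _ _ + _] := KVP i; exact.
  + pose D := \bigcup_n (V n `\` K n).
    pose E := (\bigcup_n K n) `\` \big[setU/set0]_(i < N) K i.
    have mD : measurable D.
      by apply: bigcup_measurable => n _; exact: measurableD.
    have mE : measurable E.
      apply: measurableD; first exact: bigcup_measurable.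
      exact: bigsetU_measurable.
    apply: (@le_trans _ _ (mu (D `|` E))).
      apply: le_measure; rewrite ?inE; [|exact: measurableU|].
        apply: measurableD; first exact: bigcup_measurable.
        exact: bigsetU_measurable.
      move=> x [[n _ Vx] nK].
      have [Kx|nKx] := EM (K n x); last by left; exists n.
      by right; split => //; exists n.
    apply: le_trans (measureU2 _ mD mE) _.
    rewrite [e in leRHS](splitr e) EFinD; apply: leeD => //.
    apply: (@le_trans _ _ (\sum_(0 <= n <oo) mu (V n `\` K n))).
      by apply: measure_sigma_subadditive => // n; exact: measurableD.
    apply: le_trans (epsilon_trick0 xpredT (ltW e2)).
    by apply: lee_nneseries => // n _; have [_ _ _ _] := KVP n.
Qed.

(** Open sets are approximated from inside by their closed pieces, hence all Borel sets are
    approximable. Compactness of the space makes the inner closed sets compact; the Hausdorff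
    property makes compact sets Borel. *)
Lemma regular_measure_fsigma : hausdorff_space T -> compact [set: T] ->
  (forall V : set T, open V -> exists2 F : nat -> set T,
    (forall n, closed (F n)) & V = \bigcup_n F n) ->
  regular_measure mu.
Proof.
move=> hT cT openF.
have approx_open V : open V -> approximable V.
  move=> oV e e0; have [F cF VF] := openF V oV.
  have [n Fn] := @fsigma_residual F e e0 (fun n => borel_closed (cF n)).
  exists (\big[setU/set0]_(i < n) F i), V; split=> //.
  - by apply: closed_bigsetU => i _; exact: cF.
  - by rewrite VF; exact: bigsetU_bigcup.
  - by rewrite [X in mu (X `\` _)]VF.
have approxA : (@measurable _ (borel T)) `<=` approximable.
  by apply: smallest_sub approx_open; exact: approx_sigma_algebra.
have mu_split (A B : set (borel T)) :
    measurable A -> measurable B -> A `<=` B -> mu B <= mu A + mu (B `\` A).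
  move=> mA mB AB; rewrite -[in leLHS](setDUK AB).
  by apply: measureU2 => //; exact: measurableD.
move=> A mA; have tA := approxA _ mA.
split; apply/eqP; rewrite eq_le; apply/andP; split.
- apply/lee_addgt0Pr => e /tA[K [V [cK oV KA AV KV]]].
  have [mK mV] := (borel_closed cK, borel_open oV).
  apply: (@le_trans _ _ (mu V)); first by apply: le_measure; rewrite ?inE.
  apply: le_trans (mu_split _ _ mK mV (subset_trans KA AV)) _.
  apply: leeD => //; apply: ereal_sup_ubound; exists K => //; split => //.
  exact: (subclosed_compact cK cT).
- apply: ge_ereal_sup => _ [K [cK KA] <-]; apply: le_measure; rewrite ?inE//.
  by apply: borel_closed; exact: compact_closed.
- apply: le_ereal_inf_tmp => _ [V [oV AV] <-].
  apply: le_measure; rewrite ?inE//.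
  exact: borel_open.
- apply/lee_addgt0Pr => e /tA[K [V [cK oV KA AV KV]]].
  have [mK mV] := (borel_closed cK, borel_open oV).
  apply: (@le_trans _ _ (mu V)); first by apply: ereal_inf_lbound; exists V.
  apply: le_trans (mu_split _ _ mK mV (subset_trans KA AV)) _.
  by apply: leeD => //; apply: le_measure; rewrite ?inE.
Qed.

End Regularity.

(** * Algebra of continuous real functions *)

Section ContinuousRealFunctions.
Variables (R : realType) (T : topologicalType) (f g : T -> R).
Hypotheses (cf : continuous f) (cg : continuous g).

Lemma continuous_funD : continuous (fun x => f x + g x).
Proof. by move=> x; apply: cvgD; [exact: cf|exact: cg]. Qed.

Lemma continuous_funB : continuous (fun x => f x - g x).
Proof. by move=> x; apply: cvgB; [exact: cf|exact: cg]. Qed.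

Lemma continuous_funM : continuous (fun x => f x * g x).
Proof. by move=> x; apply: cvgM; [exact: cf|exact: cg]. Qed.

End ContinuousRealFunctions.

(** * Topology of the Stone space *)

Section StoneSpaceTheory.
Variables (L : language) (X : bool_subalgebra (FO L)).
Implicit Types (T : stone X) (a b : FO L).

Lemma stone_sub T a : ultrafilter_set T a -> subalgebra_set X a.
Proof. by have [[sub _ _ _ _] _] := ultrafilter_setP T; exact: sub. Qed.

Lemma stone_top T : ultrafilter_set T Order.top.
Proof. by have [[]] := ultrafilter_setP T. Qed.

Lemma stone_bot T : ~ ultrafilter_set T Order.bottom.
Proof. by have [[]] := ultrafilter_setP T. Qed.

Lemma stone_meet T a b : subalgebra_set X a -> subalgebra_set X b ->
  ultrafilter_set T (Order.meet a b) <->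
  ultrafilter_set T a /\ ultrafilter_set T b.
Proof.
move=> Xa Xb; have [[_ _ _ TI Tle] _] := ultrafilter_setP T.
split=> [Tab|[Ta Tb]]; last exact: TI.
by split; apply: Tle Tab _ _ => //; rewrite ?leIl ?leIr.
Qed.

Lemma stone_compl T a : subalgebra_set X a ->
  ultrafilter_set T (Order.compl a) <-> ~ ultrafilter_set T a.
Proof.
move=> Xa; have [[sub Ttop T0 TI Tle] Tmax] := ultrafilter_setP T.
split=> [Tca Ta|nTa]; first by apply: T0; rewrite -(meetxC a); exact: TI.
apply: contrapT => nTca; apply: nTa.
(* [V] is the filter generated by [T] and [a]. It is proper, since a [c] in [T] disjoint from [a]
   would lie below the complement of [a]; maximality then puts [a] in [T]. *)
pose V := [set b | subalgebra_set X b /\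
  exists2 c, ultrafilter_set T c & (Order.meet c a <= b)%O].
have VT : ultrafilter_set T `<=` V.
  by move=> c Tc; split; [exact: sub|exists c; rewrite // leIl].
suff /Tmax/(_ VT) -> : proper_filter_on X V.
  by split=> //; exists Order.top; rewrite // leIr.
split.
- by move=> b [].
- exact: VT.
- move=> [_ [c Tc]]; rewrite lex0 disj_leC => cle; apply: nTca.
  by apply: Tle Tc _ cle; exact: subalgebra_compl.
- move=> b1 b2 [Xb1 [c1 Tc1 le1]] [Xb2 [c2 Tc2 le2]]; split.
    exact: subalgebra_meet.
  exists (Order.meet c1 c2); first exact: TI.
  by rewrite lexI (le_trans _ le1) ?(le_trans _ le2)// leI2// ?leIl ?leIr.
- move=> b1 b2 [_ [c Tc le1]] Xb2 b12; split=> //; exists c => //.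
  exact: le_trans b12.
Qed.

Lemma stone_KI a b : subalgebra_set X a -> subalgebra_set X b ->
  stone_K X (Order.meet a b) = stone_K X a `&` stone_K X b.
Proof. by move=> Xa Xb; apply/seteqP; split=> T /= /(stone_meet T Xa Xb). Qed.

Lemma stone_KC a : subalgebra_set X a ->
  stone_K X (Order.compl a) = ~` stone_K X a.
Proof. by move=> Xa; apply/seteqP; split=> T /= /(stone_compl T Xa). Qed.

Lemma stone_K0 : stone_K X Order.bottom = set0.
Proof. by apply/seteqP; split=> T //= /stone_bot. Qed.

Lemma stone_KT : stone_K X Order.top = setT.
Proof. by apply/seteqP; split=> T //= _; exact: stone_top. Qed.

Lemma stone_K_open a : subalgebra_set X a -> open (stone_K X a).
Proof.
move=> Xa; exists [set stone_K X a]; last by rewrite bigcup_set1.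
move=> _ ->; apply: finI_from1; by exists a.
Qed.

Lemma stone_K_closed a : subalgebra_set X a -> closed (stone_K X a).
Proof.
move=> Xa; rewrite -[stone_K X a]setCK -stone_KC//; apply: open_closedC.
by apply: stone_K_open; exact: subalgebra_compl.
Qed.

Lemma stone_K_bigcap (s : seq (set (stone X))) :
  (forall i, i \in s -> exists2 a, subalgebra_set X a & stone_K X a = i) ->
  exists2 a, subalgebra_set X a & stone_K X a = \bigcap_(i in [set` s]) i.
Proof.
elim: s => [|i s IH] sX.
  exists Order.top; first exact: subalgebra_top.
  by rewrite classical_sets.set_nil bigcap_set0 stone_KT.
have [a Xa aE] := sX i (mem_head _ _).
have [j js|b Xb bE] := IH; first by apply: sX; rewrite inE js orbT.
exists (Order.meet a b); first exact: subalgebra_meet.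
rewrite stone_KI// aE bE (_ : [set` i :: s] = i |` [set` s]) ?bigcap_setU1//.
by apply/seteqP; split=> j /=; rewrite inE => /predU1P.
Qed.

(** [X] is closed under meets, so finite intersections of subbasic sets are again of the form
    [stone_K X a], and the subbase is a base. *)
Lemma stone_K_base (A : set (stone X)) T : open A -> A T ->
  exists a, [/\ subalgebra_set X a, ultrafilter_set T a & stone_K X a `<=` A].
Proof.
move=> [D' D'sub <-] [B D'B BT].
have [E EX BE] := D'sub _ D'B.
have [a Xa aE] :=
  @stone_K_bigcap (finmap.enum_fset E) (fun i => set_mem \o EX i).
exists a; split=> //.
  by rewrite -[ultrafilter_set _ _]/(stone_K X a T) aE BE.
by move=> U; rewrite aE BE => BU; exists B.
Qed.

Lemma stone_open_bigcup (A : set (stone X)) : open A ->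
  exists2 e : nat -> FO L, (forall n, subalgebra_set X (e n)) &
    A = \bigcup_n stone_K X (e n).
Proof.
move=> oA; have /countable_injP[f finj] := countable_FO L.
(* [P n] has at most one element. When it is empty, the default [Order.bottom] contributes the empty
   clopen set. *)
pose P n := [set a | [/\ subalgebra_set X a, stone_K X a `<=` A & f a = n]].
have P0 n : subalgebra_set X (xget Order.bottom (P n)) /\
    stone_K X (xget Order.bottom (P n)) `<=` A.
  case: xgetP => [a _ []//|_]; split; first exact: subalgebra_bot.
  by rewrite stone_K0.
exists (fun n => xget Order.bottom (P n)) => [n|]; first exact: (P0 n).1.
apply/seteqP; split=> [T AT|T [n _]]; last exact: (P0 n).2.
have [a [Xa Ta sub]] := stone_K_base oA AT.
exists (f a) => //; rewrite (_ : xget _ _ = a)//.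
apply: xget_subset1 => // b c [_ _ fb] [_ _ fc].
by apply: finj; rewrite ?inE// fb fc.
Qed.

(** An ultrafilter [F] on the space converges to the point formed by the formulas whose clopen set
    belongs to [F]. *)
Lemma stone_compact : compact [set: stone X].
Proof.
rewrite compact_ultra => F FF _.
pose U : set (FO L) := [set a | subalgebra_set X a /\ F (stone_K X a)].
have UU : ultrafilter_on X U.
  apply: ultrafilter_onP => [|a Xa]; last first.
    have [Fa|Fa] := in_ultra_setVsetC (stone_K X a) FF; [by left|right].
    by split; [exact: subalgebra_compl|rewrite stone_KC].
  split.
  - by move=> a [].
  - by split; [exact: subalgebra_top|rewrite stone_KT; exact: filterT].
  - by move=> [_]; rewrite stone_K0; exact: filter_not_empty.
  - move=> a b [Xa Fa] [Xb Fb]; split; first exact: subalgebra_meet.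
    by rewrite stone_KI//; exact: filterI.
  - move=> a b [Xa Fa] Xb ab; split=> //; apply: filterS Fa => T.
    by move: ab => /meet_idPl <- /(stone_meet T Xa Xb)[].
exists (Ultrafilter UU); split=> // A; rewrite nbhsE => -[B [oB BU] BA].
have [a [Xa [_ Fa] sub]] := stone_K_base oB BU.
by apply: filterS Fa => T /sub/BA.
Qed.

(** A formula in [p] but not in [q] would separate the two points by its clopen set and the
    complement. So [p] is contained in [q], and maximality gives equality. *)
Lemma stone_hausdorff : hausdorff_space (stone X).
Proof.
move=> p q pq.
have sub : ultrafilter_set p `<=` ultrafilter_set q.
  move=> a pa; have Xa := stone_sub pa.
  apply: contrapT => /(stone_compl q Xa) qca.
  have oa := stone_K_open Xa; have oca := stone_K_open (subalgebra_compl Xa).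
  have [T []] := pq _ _ (open_nbhs_nbhs (conj oa pa))
    (open_nbhs_nbhs (conj oca qca)).
  by move=> Ta /(stone_compl T Xa).
have [_ pmax] := ultrafilter_setP p; have [qF _] := ultrafilter_setP q.
have := pmax _ qF sub; case: p q {pq sub pmax qF} => [p pP] [q qP] /= pq.
by rewrite -pq in qP *; rewrite (Prop_irrelevance pP qP).
Qed.

(** * Borel measures on the Stone space *)

Lemma stone_regular (R : realType) (mu : probability (borel (stone X)) R) :
  regular_measure mu.
Proof.
apply: regular_measure_fsigma; [exact: stone_hausdorff|exact: stone_compact|].
move=> V /stone_open_bigcup[e Xe ->]; exists (fun n => stone_K X (e n)) => // n.
exact: stone_K_closed.
Qed.

Definition stone_cylinders : set (set (stone X)) :=
  [set stone_K X a | a in subalgebra_set X].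

Lemma stone_cylinders_setI : setI_closed stone_cylinders.
Proof.
move=> _ _ [a Xa <-] [b Xb <-]; rewrite -stone_KI//.
by exists (Order.meet a b) => //; exact: subalgebra_meet.
Qed.

Lemma stone_borelE :
  @measurable _ (borel (stone X)) = <<s stone_cylinders >>.
Proof.
apply/seteqP; split; last first.
  by apply: sub_sigma_algebra2 => _ [a Xa <-]; exact: stone_K_open.
apply: smallest_sub; first exact: smallest_sigma_algebra.
move=> V /stone_open_bigcup[e Xe ->]; apply: sigma_algebra_bigcup => n.
by apply: sub_sigma_algebra; exists (e n).
Qed.

Lemma measurable_stone_K a : subalgebra_set X a ->
  measurable (stone_K X a : set (borel (stone X))).
Proof. by move=> /stone_K_open/borel_open. Qed.

Lemma stone_measure_unique (R : realType)
    (mu nu : probability (borel (stone X)) R) :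
  (forall a, subalgebra_set X a -> mu (stone_K X a) = nu (stone_K X a)) ->
  same_measure mu nu.
Proof.
move=> munu A mA.
have GT (n : nat) : stone_cylinders setT.
  by exists Order.top; [exact: subalgebra_top|exact: stone_KT].
apply: (measure_unique _ _ stone_borelE stone_cylinders_setI GT _ mu nu) => //.
- by rewrite bigcup_const//; exists 0%N.
- by move=> _ [a Xa <-]; exact: munu.
- by move=> _; rewrite -ge0_fin_numE// fin_num_measure.
Qed.

(** * Integrals of step and continuous functions, and weak convergence *)

Lemma Rintegral_stone_K (R : realType)
    (mu : probability (borel (stone X)) R) a : subalgebra_set X a ->
  \int[mu]_(T in [set: stone X]) (\1_(stone_K X a) T : R) =
  fine (mu (stone_K X a)).
Proof.
move=> Xa; rewrite /Rintegral integral_indic ?setIT//.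
exact: measurable_stone_K.
Qed.

Lemma stone_indic_continuous (R : realType) a : subalgebra_set X a ->
  continuous (\1_(stone_K X a) : stone X -> R).
Proof.
move=> Xa; apply/continuousP => B _; rewrite preimage_indic.
case: ifP => _; case: ifP => _.
- exact: openT.
- exact: stone_K_open.
- exact/closed_openC/stone_K_closed.
- exact: open0.
Qed.

(* The first pair whose clopen set contains the point gives the value. *)
Definition stone_step (R : realType) (s : seq (FO L * R)) (T : stone X) : R :=
  foldr (fun p r => r + \1_(stone_K X p.1) T * (p.2 - r)) 0 s.

Lemma stone_step_continuous (R : realType) (s : seq (FO L * R)) :
  (forall p, p \in s -> subalgebra_set X p.1) -> continuous (stone_step s).
Proof.
elim: s => [|p s IH] sX; first exact: (@cst_continuous (stone X) R 0).
have cs : continuous (stone_step s).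
  by apply: IH => q qs; apply: sX; rewrite inE qs orbT.
have ck := @stone_indic_continuous R _ (sX p (mem_head _ _)).
change (continuous (fun T : stone X =>
  stone_step s T + \1_(stone_K X p.1) T * (p.2 - stone_step s T))).
apply: continuous_funD => //; apply: continuous_funM => //.
by apply: continuous_funB => //; exact: cst_continuous.
Qed.

(** Each point has a clopen neighbourhood on which [f] stays within [e] of its value there;
    compactness keeps finitely many. They may overlap, but the first one containing a point is as
    good as any other. *)
Lemma stone_step_approx (R : realType) (f : stone X -> R) (e : R) :
  continuous f -> 0 < e -> exists2 s : seq (FO L * R),
    (forall p, p \in s -> subalgebra_set X p.1) &
    forall T, `|f T - stone_step s T| <= e.
Proof.
move=> cf e0; have := stone_compact; rewrite compact_cover.
pose D := [set p : FO L * R | subalgebra_set X p.1 /\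
  forall T, stone_K X p.1 T -> `|f T - p.2| <= e].
move=> /(_ _ D (fun p => stone_K X p.1))[p [Xp _]|T _|D' D'D cov].
- exact: stone_K_open.
- have oB : open (f @^-1` ball (f T) e).
    by move/continuousP : cf; apply; exact: ball_open.
  have [a [Xa Ta aB]] := stone_K_base oB (ballxx (f T) e0).
  exists (a, f T) => //; split=> // U /aB.
  by rewrite /= /ball/= distrC => /ltW.
exists (finmap.enum_fset D') => [p /D'D/set_mem[]//|T].
have {}D'D p : p \in finmap.enum_fset D' -> D p by move=> /D'D/set_mem.
have {cov} : exists2 p, p \in finmap.enum_fset D' & stone_K X p.1 T.
  by have [p] := cov T Logic.I; exists p.
elim: (finmap.enum_fset D') D'D => [|p s IH] sD [q] //= qs Tq.
have [Tp|nTp] := EM (stone_K X p.1 T).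
  rewrite indicE mem_set// mul1r [_ + (p.2 - _)]addrC subrK.
  by have [_] := sD p (mem_head _ _); exact.
rewrite indicE memNset// mul0r addr0; apply: IH => [r rs|].
  by apply: sD; rewrite inE rs orbT.
exists q => //; move: qs; rewrite inE => /predU1P[qp|//].
by case: nTp; rewrite -qp.
Qed.

Lemma stone_integrable (R : realType) (mu : probability (borel (stone X)) R)
    (f : stone X -> R) :
  continuous f -> mu.-integrable setT (EFin \o (f : borel (stone X) -> R)).
Proof.
move=> cf; apply: measurable_bounded_integrable => //.
- by rewrite -ge0_fin_numE// fin_num_measure.
- apply: (measurability _ (measurable_realfun.RGenOInfty.measurableE R)).
  move=> _ [_ [x ->] <-].
  by rewrite setTI; apply: borel_open; move/continuousP : cf; apply.
- have [M [Mreal fM]] : bounded_set (range f).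
    apply: compact_bounded; apply: continuous_compact stone_compact.
    exact: continuous_subspaceT.
  by exists M; split=> // y /fM fy T _; apply: fy; exists T.
Qed.

(** The factor [\1_(stone_K X a)] strengthens the induction: unfolding one step of [stone_step]
    multiplies the rest by a further indicator, which is absorbed by a meet. *)
Lemma cvg_Rintegral_step (R : realType)
    (mu : nat -> probability (borel (stone X)) R) (s : seq (FO L * R)) a :
  (forall b, subalgebra_set X b -> cvgn (fun n => fine (mu n (stone_K X b)))) ->
  (forall p, p \in s -> subalgebra_set X p.1) -> subalgebra_set X a ->
  cvgn (fun n => \int[mu n]_T (\1_(stone_K X a) T * stone_step s T)).
Proof.
move=> cmu; elim: s a => [|p s IH] a sX Xa.
  rewrite (_ : (fun n => _) = fun=> 0); first exact: is_cvg_cst.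
  apply/funext => n; rewrite (@eq_Rintegral _ _ _ _ setT (fun=> 0)).
    by rewrite Rintegral_cst// mul0r.
  by move=> T _; rewrite mulr0.
have Xp := sX p (mem_head _ _).
have {}sX q : q \in s -> subalgebra_set X q.1.
  by move=> qs; apply: sX; rewrite inE qs orbT.
have Xap := subalgebra_meet Xa Xp.
have cs := stone_step_continuous sX.
pose h b T := \1_(stone_K X b) T * stone_step s T.
have ch b : subalgebra_set X b -> continuous (h b).
  by move=> Xb; apply: continuous_funM => //; exact: stone_indic_continuous.
have ck b := @stone_indic_continuous R b.
rewrite (_ : (fun n => _) = (fun n => \int[mu n]_T h a T +
    p.2 * fine (mu n (stone_K X (Order.meet a p.1))) -
    \int[mu n]_T h (Order.meet a p.1) T)).
  apply: is_cvgB; last exact: IH.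
  by apply: is_cvgD; [exact: IH|apply: is_cvgMr; exact: cmu].
apply/funext => n; rewrite -Rintegral_stone_K//.
have ik := stone_integrable (mu n) (ck _ Xap).
rewrite -RintegralZl// -RintegralD//; last 2 first.
- exact: stone_integrable (ch _ Xa).
- apply: (stone_integrable (mu n)); apply: continuous_funM; last exact: ck.
  exact: cst_continuous.
rewrite -RintegralB//; last 2 first.
- apply: (stone_integrable (mu n)); apply: continuous_funD; first exact: ch.
  by apply: continuous_funM; [exact: cst_continuous|exact: ck].
- exact: stone_integrable (ch _ Xap).
apply: eq_Rintegral => T _; rewrite /h /= stone_KI// indicI /=.
ring.
Qed.

(** The integrals of [f] form a Cauchy sequence, because those of a uniformly close step function
    converge. *)
Lemma weakly_convergentP (R : realType)
    (mu : nat -> probability (borel (stone X)) R) :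
  (forall a, subalgebra_set X a -> cvgn (fun n => fine (mu n (stone_K X a)))) ->
  weakly_convergent mu.
Proof.
move=> cmu f cf; apply: cauchy_cvg; apply: cauchy_exP => e e0.
have e2 : 0 < e / 2 by rewrite divr_gt0.
have [s sX sf] := stone_step_approx cf e2.
have cs := stone_step_continuous sX.
have /cvg_ex[l sl] := cvg_Rintegral_step cmu sX (subalgebra_top X).
(* [cauchy_exP] asks only for the centre of a ball of radius [e] that eventually contains the
   integrals; the limit for the step function serves, with e/2 for its convergence and e/2 for the
   approximation. *)
exists l; move/cvgrPdist_lt : sl => /(_ _ e2); apply: filterS => n.
rewrite (@eq_Rintegral _ _ _ _ setT
  (stone_step s : borel (stone X) -> R)); last first.
  by move=> T _; rewrite stone_KT indicT mul1r.
move=> ln; rewrite /ball/= (splitr e) -(subrKA (\int[mu n]_T stone_step s T)).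
apply: le_lt_trans (ler_normD _ _) _; apply: ltr_leD => //.
have [is_ if_] := (stone_integrable (mu n) cs, stone_integrable (mu n) cf).
have isf : (mu n).-integrable setT
    (EFin \o (fun T : borel (stone X) => stone_step s T - f T)).
  by apply: stone_integrable; exact: continuous_funB.
rewrite -RintegralB//; apply: le_trans (le_normr_Rintegral _ isf) _ => //.
apply: (@le_trans _ _ (\int[mu n]_(_ in [set: borel (stone X)]) (e / 2)));
  last first.
  have muT : fine (mu n setT) = 1 by rewrite probability_setT.
  by rewrite Rintegral_cst// [fine _]muT mulr1.
apply: le_Rintegral => //.
- exact: integrable_norm.
- exact: (stone_integrable (mu n) (@cst_continuous _ _ _)).
- move=> T _; rewrite distrC; exact: sf.
Qed.

End StoneSpaceTheory.

(** * The measure attached to a finite structure *)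

Section StoneMeasure.
Variables (R : realType) (L : language) (X : bool_subalgebra (FO L)).
Implicit Type G : fin_structure L.

Lemma type_ultrafilter (M : structure L) (v : nat -> M) :
  ultrafilter_on X [set a | subalgebra_set X a /\ sat v (repr a)].
Proof.
apply: ultrafilter_onP => [|a Xa]; last first.
  have [va|va] := EM (sat v (repr a)); [by left|right].
  by split; [exact: subalgebra_compl|exact/sat_compl].
split.
- by move=> a [].
- by split; [exact: subalgebra_top|exact: sat_top].
- by case=> _ /sat_bot.
- by move=> a b [Xa va] [Xb vb]; split; [exact: subalgebra_meet|exact/sat_meet].
- move=> a b [Xa va] Xb /meet_idPl ab; split=> //.
  by move: va; rewrite -ab => /sat_meet[].
Qed.

Definition type_of (M : structure L) (v : nat -> M) : stone X :=
  Ultrafilter (type_ultrafilter v).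

(* The value of the variable x_(i+1) is the element of G numbered by the
   (i+1)-th digit of x in base #|G|. *)
Definition sample G (x : R) (i : nat) : G :=
  nth (fs_default G) (enum G) (Num.truncn (x * (#|G| ^ i.+1)%:R) %% #|G|)%N.

Definition digit_tuple G (p k : nat) : p.-tuple G :=
  [tuple nth (fs_default G) (enum G) (digit #|G| p k i) | i < p].

(** Both sides have [#|G| ^ p] elements, and a tuple determines the digits because [enum G] has no
    repetition. *)
Lemma digit_tuple_bij G p :
  bijective (fun k : 'I_(#|G| ^ p) => digit_tuple G p k).
Proof.
apply: inj_card_bij; last by rewrite card_tuple card_ord.
move=> k l /(congr1 (fun t : p.-tuple G => tnth t)) kl; apply: val_inj.
apply: (digit_inj (fcarrier_gt0 G)) (ltn_ord k) (ltn_ord l) _ => i ip.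
have := congr1 (fun h => h (Ordinal ip)) kl; rewrite !tnth_mktuple => /eqP.
by rewrite nth_uniq ?enum_uniq -?cardE ?ltn_mod ?fcarrier_gt0// => /eqP.
Qed.

(** Only the first [nvars f] values of the infinite assignment matter, and these are read off a
    single truncation of [x]. *)
Lemma sat_sample G (f : formula L) (x : R) :
  @sat L (structure_of_fin G) (sample G x) f <->
  digit_tuple G (nvars f) (Num.truncn (x * (#|G| ^ nvars f)%:R)) \in
    solutions f G (nvars f).
Proof.
rewrite inE; set t := digit_tuple _ _ _.
have tE : {in free_vars f, sample G x =1 nth (fs_default G) t}.
  move=> i fi; have ip := free_vars_lt_nvars fi.
  rewrite -(tnth_nth _ _ (Ordinal ip)) tnth_mktuple /sample.
  by rewrite digit_truncn// fcarrier_gt0.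
have st := @sat_agree L (structure_of_fin G) f _ _ tE.
by split=> [/st sf|/asboolP/st]; first exact/asboolP.
Qed.

Definition random_type G (x : R) : stone X :=
  @type_of (structure_of_fin G) (sample G x).

Lemma random_type_preimage G a : subalgebra_set X a ->
  random_type G @^-1` stone_K X a =
  [set x : R | digit_tuple G (nvars (repr a))
      (Num.truncn (x * (#|G| ^ nvars (repr a))%:R)) \in
    solutions (repr a) G (nvars (repr a))].
Proof.
move=> Xa; apply/seteqP; split=> x /=; first by move=> [_ /sat_sample].
by move/sat_sample.
Qed.

Let pow_gt0 G n : (0 < #|G| ^ n)%N.
Proof. by rewrite expn_gt0 fcarrier_gt0. Qed.

Lemma measurable_random_type G :
  measurable_fun setT (random_type G : measurableTypeR R -> borel (stone X)).
Proof.
apply: (measurability _ (stone_borelE X)) => _ [_ [a Xa <-] <-].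
rewrite setTI random_type_preimage//.
exact: (measurable_truncn (pow_gt0 G _) (fun k => digit_tuple G _ k \in _)).
Qed.

HB.instance Definition _ G :=
  isMeasurableFun.Build _ _ _ _
    (random_type G : measurableTypeR R -> borel (stone X))
    (measurable_random_type G).

Definition stone_measure G : probability (borel (stone X)) R :=
  distribution (@unif01 R)
    (random_type G : {mfun measurableTypeR R >-> borel (stone X)}).

(** The preimage of the clopen set is a union of intervals of equal length, one for each solution
    tuple through the bijection with digit strings. *)
Lemma stone_measure_K G a : subalgebra_set X a ->
  stone_measure G (stone_K X a) = (density R a G)%:E.
Proof.
move=> Xa; rewrite -[LHS]/(unif01 (random_type G @^-1` stone_K X a)).
rewrite random_type_preimage//.
rewrite (unif01_truncn _ (pow_gt0 G _) (fun k => digit_tuple G _ k \in _)).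
rewrite /density /formula_density; congr (_%:R / _)%:E.
have [h hk kh] := digit_tuple_bij G (nvars (repr a)).
rewrite -[RHS](card_imset _ (can_inj kh)); apply: eq_card => k; rewrite inE.
apply/idP/imsetP => [kS|[t tS ->]]; last by rewrite kh.
by exists (digit_tuple G (nvars (repr a)) k); rewrite ?hk.
Qed.

End StoneMeasure.

Theorem theorem1 (R : realType) (L : language) (X : bool_subalgebra (FO L)) :
  exists mu : fin_structure L -> probability (borel (stone X)) R,
    [/\ forall G : fin_structure L, regular_measure (mu G),
        (forall G H : fin_structure L,
            same_measure (mu G) (mu H) <->
            (forall phi : FO L, (X : set (FO L)) phi -> density R phi G = density R phi H)),
        (FO_sentences L `<=` X \/ FO_quantifier_free L `<=` X ->
         forall G H : fin_structure L,
           same_measure (mu G) (mu H) <-> isomorphic G H),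
        (forall (G : fin_structure L) (phi : FO L), (X : set (FO L)) phi ->
            density R phi G =
            \int[mu G]_(T in [set: stone X]) (\1_(stone_K X phi) T : R)) &
        (forall G : nat -> fin_structure L,
            X_convergent R X G <-> weakly_convergent (fun n => mu (G n))) /\
        (forall (G : nat -> fin_structure L)
                (nu : probability (borel (stone X)) R),
            regular_measure nu ->
            weakly_converges_to (fun n => mu (G n)) nu ->
            forall phi : FO L, (X : set (FO L)) phi ->
              (fun n => density R phi (G n)) @ \oo -->
              \int[nu]_(T in [set: stone X]) (\1_(stone_K X phi) T : R))].
Proof.
exists (stone_measure R X).
have same_density G H : same_measure (stone_measure R X G) (stone_measure R X H) <->
    (forall phi, subalgebra_set X phi -> density R phi G = density R phi H).
  split=> [GH phi Xphi|GH].
    have := GH _ (measurable_stone_K Xphi).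
    by rewrite !stone_measure_K// => -[].
  apply: stone_measure_unique => a Xa.
  by rewrite !stone_measure_K// GH.
have densityK G phi : subalgebra_set X phi -> density R phi G =
    \int[stone_measure R X G]_(T in [set: stone X]) (\1_(stone_K X phi) T : R).
  by move=> Xphi; rewrite Rintegral_stone_K// stone_measure_K.
have densityKn (G : nat -> fin_structure L) phi : subalgebra_set X phi ->
    (fun n => density R phi (G n)) = (fun n =>
    \int[stone_measure R X (G n)]_(T in [set: stone X]) (\1_(stone_K X phi) T : R)).
  by move=> Xphi; apply/funext => n; exact: densityK.
split=> //.
- by move=> G; exact: stone_regular.
- move=> XP G H; rewrite same_density; split; first exact: density_isomorphic.
  by move=> GH phi _; exact: isomorphic_density.
split=> [G|G nu _ Gnu phi Xphi]; last first.
  (* Since [stone_K X phi] is clopen, its indicator is an admissible test function. *)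
  by rewrite densityKn//; apply: Gnu; exact: stone_indic_continuous.
split=> [cG|cG phi Xphi]; last first.
  by rewrite densityKn//; apply: cG; exact: stone_indic_continuous.
apply: weakly_convergentP => a Xa.
by under eq_fun do rewrite stone_measure_K//=; exact: cG.
Qed.
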